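(* Let $d \ge 2$, let $P \le G(d)$ be an essential pattern group of pattern size $d$, and let $G_P$ be the finitely constrained group of binary rooted tree automorphisms defined by $P$. The following conditions are equivalent. (i) The Hausdorff dimension of $G_P$ is $\dim_{\mathcal{H}}(G_P) = 1 - \frac{1}{2^{d-1}}$. (ii) $P$ is a proper subgroup of $G(d)$ that contains the commutator subgroup $[G(d),G(d)]$. (iii) $P$ is a maximal subgroup of $G(d)$ that does not contain the element $a_{d-1}$.
   Context: Let $X=\{0,1\}$, let $X^n$ be the set of words of length $n$ over $X$, and let $X^*=\bigcup_{n\ge 0}X^n$, viewed as the binary rooted tree with root the empty word $\emptyset$, in which each vertex $w$ has the two children $w0,w1$. Put $X^{[d]}=\bigcup_{i=0}^{d}X^i$ (the finite binary rooted tree of depth $d$) and $X^{(d)}=\bigcup_{i=0}^{d-1}X^i$. Let $G=\mathrm{Aut}(X^* )$ and $G(d)=\mathrm{Aut}(X^{[d]})$ be the groups of rooted tree automorphisms, acting on the left. For $g\in G$ and $w\in X^*$, the section $g_w\in G$ is the unique automorphism with $g(wv)=g(w)g_w(v)$ for all $v \in X^*$. The label (activity) $g_{(w)}\in C_2=\{0,1\}$ of $g$ at $w$ is $1$ if $g_w$ exchanges the two vertices of $X^1$, and $0$ otherwise. Labels $g_{(w)}$ for $g\in G(d)$ and $w\in X^{(d)}$ are defined in the same way. An element of $G(d)$ is determined by its labels, and $G(d)$ is thereby identified with the set of all maps $X^{(d)}\to C_2$ (patterns of size $d$). For $0\le i\le d-1$, $a_i\in G(d)$ is the element with $(a_i)_{(w)}=1$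 if and only if $w=0^i$. A pattern group of size $d$ is a subgroup $P\le G(d)$. It is essential if for all $g\in P$ and $i\in\{0,1\}$ there is $h_i\in P$ with $(h_i)_{(w)}=g_{(iw)}$ for all $w\in X^{(d-1)}$. The finitely constrained group defined by $P$ is $G_P=\{g\in G \mid \text{for every } w\in X^* \text{ the pattern } X^{(d)} \to C_2,\ v\mapsto g_{(wv)}, \text{ belongs to } P\}$; it is a closed subgroup of $G$. Equip $G$ with the metric in which the distance between $g\ne h$ is $1/[G:G_n]$, where $G_n$ is the pointwise stabilizer of $X^n$ in $G$ and $n$ is the smallest $k$ for which there is $u\in X^k$ with $g_{(u)}\neq h_{(u)}$. The Hausdorff dimension $\dim_{\mathcal{H}}(H)$ of a closed subgroup $H$ of $G$ is taken with respect to this metric; it is given by $\dim_{\mathcal{H}}(H)=\liminf_{n\to\infty}\frac{\log_2[H:H_n]}{2^n-1}$, where $H_n=H\cap G_n$. *)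

(* Defs.v *)
From HB Require Import structures.
From mathcomp Require Import all_boot all_order all_algebra.
From mathcomp Require Import all_fingroup all_solvable finmap.
From mathcomp Require Import all_classical all_reals all_analysis.

Set Implicit Arguments.
Unset Strict Implicit.
Unset Printing Implicit Defensive.

Import Order.TTheory GRing.Theory Num.Theory.

Local Open Scope nat_scope.
Local Open Scope group_scope.
Local Open Scope classical_set_scope.

(* Vertices of the binary rooted tree X^* are words w : seq bool, with false
   and true standing for the letters 0 and 1; the children of w are
   rcons w false and rcons w true. *)
Definition child (u v : seq bool) : bool := [exists x : bool, v == rcons u x].

(* The section g_w of a level-preserving g, read off g(wv) = g(w) g_w(v):
   erasing the first |w| = |g(w)| letters of g(wv) leaves g_w(v). *)
Definition section (g : seq bool -> seq bool) (w v : seq bool) : seq bool :=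
  drop (size w) (g (w ++ v)).

Definition label (g : seq bool -> seq bool) (w : seq bool) : bool :=
  (section g w [:: false] == [:: true]) &&
  (section g w [:: true] == [:: false]).

Section Children.
Implicit Types (u v w : seq bool) (g : seq bool -> seq bool).

Lemma childP u v : reflect (exists x, v = rcons u x) (child u v).
Proof. by apply: (iffP existsP) => -[x] => [/eqP vE|->]; exists x. Qed.

Lemma child_rcons u x : child u (rcons u x).
Proof. by apply/childP; exists x. Qed.

Lemma child_size u v : child u v -> size v = (size u).+1.
Proof. by move=> /childP[x ->]; rewrite size_rcons. Qed.

End Children.

Record tree_aut : Type := TreeAut {
  ta_fun :> seq bool -> seq bool;
  ta_bij : bijective ta_fun;
  ta_child : forall u v, child (ta_fun u) (ta_fun v) = child u v }.

Lemma tree_aut_ext (g h : tree_aut) : g =1 h -> g = h.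
Proof.
case: g h => [g gb gc] [h hb hc] /= /funext gh.
by subst h; congr TreeAut; exact: Prop_irrelevance.
Qed.

Section TreeAutGroup.
Implicit Types g h k : tree_aut.

Definition ta_inv_fun g : seq bool -> seq bool :=
  s2val (cid2 (let: Bijective f fK Kf := ta_bij g in
    ex_intro2 (fun f' => cancel g f') (fun f' => cancel f' g) f fK Kf)).

Lemma ta_invK g : cancel g (ta_inv_fun g).
Proof. by rewrite /ta_inv_fun; case: cid2. Qed.

Lemma ta_Kinv g : cancel (ta_inv_fun g) g.
Proof. by rewrite /ta_inv_fun; case: cid2. Qed.

Lemma ta_inv_child g u v :
  child (ta_inv_fun g u) (ta_inv_fun g v) = child u v.
Proof. by rewrite -(ta_child g) !ta_Kinv. Qed.

Lemma ta_mul_child g h u v : child (g (h u)) (g (h v)) = child u v.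
Proof. by rewrite !ta_child. Qed.

Definition ta_one : tree_aut :=
  @TreeAut id (Bijective (fun=> erefl) (fun=> erefl)) (fun _ _ => erefl).

Definition ta_inv g : tree_aut :=
  TreeAut (Bijective (ta_Kinv g) (ta_invK g)) (ta_inv_child g).

Definition ta_mul g h : tree_aut :=
  @TreeAut (fun w => g (h w)) (bij_comp (ta_bij g) (ta_bij h))
    (ta_mul_child g h).

Fact ta_mulA : associative ta_mul.
Proof. by move=> g h k; exact: tree_aut_ext. Qed.

Fact ta_mul1 : left_id ta_one ta_mul.
Proof. by move=> g; exact: tree_aut_ext. Qed.

Fact ta_1mul : right_id ta_one ta_mul.
Proof. by move=> g; exact: tree_aut_ext. Qed.

Fact ta_mulV : left_inverse ta_one ta_inv ta_mul.
Proof. by move=> g; apply: tree_aut_ext => w; exact: ta_invK. Qed.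

Fact ta_Vmul : right_inverse ta_one ta_inv ta_mul.
Proof. by move=> g; apply: tree_aut_ext => w; exact: ta_Kinv. Qed.

End TreeAutGroup.

HB.instance Definition _ := gen_eqMixin tree_aut.
HB.instance Definition _ := gen_choiceMixin tree_aut.
HB.instance Definition _ :=
  isGroup.Build tree_aut ta_mulA ta_mul1 ta_1mul ta_mulV ta_Vmul.

Section TreeAutTheory.
Implicit Types (g h : tree_aut) (u v w : seq bool).

Lemma ta_mulE g h w : (g * h) w = g (h w). Proof. by []. Qed.

Lemma ta_oneE w : (1 : tree_aut) w = w. Proof. by []. Qed.

Lemma ta_nil g : g [::] = [::].
Proof.
case/lastP gE: (g [::]) => [//|u x].
have := child_rcons u x; rewrite -gE -(ta_Kinv g u) ta_child.
by move=> /child_size.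
Qed.

Lemma ta_size g w : size (g w) = size w.
Proof.
elim/last_ind: w => [|w x IH]; first by rewrite ta_nil.
by rewrite size_rcons -IH; apply: child_size; rewrite ta_child child_rcons.
Qed.

Lemma ta_rcons g w x : g (rcons w x) = rcons (g w) (x (+) label g w).
Proof.
have c b : exists y, g (rcons w b) = rcons (g w) y.
  by apply/childP; rewrite ta_child child_rcons.
have [y0 g0] := c false; have [y1 g1] := c true.
have y01 : y0 != y1.
  apply/eqP => E; have : rcons w false = rcons w true.
    by apply: (bij_inj (ta_bij g)); rewrite g0 g1 E.
  by move/rcons_inj => [].
have dE b : drop (size w) (rcons (g w) b) = [:: b].
  by rewrite -cats1 drop_size_cat ?ta_size.
rewrite /label /section !cats1 g0 g1 !dE.
by case: x; rewrite ?g0 ?g1; move: y01; clear; case: y0; case: y1.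
Qed.

Lemma ta_section g w v : g (w ++ v) = g w ++ section g w v.
Proof.
elim/last_ind: v => [|v x IH].
  by rewrite /section !cats0 drop_oversize ?cats0 ?ta_size.
rewrite /section -rcons_cat ta_rcons IH drop_rcons ?size_cat ?ta_size //.
  by rewrite rcons_cat drop_size_cat ?ta_size // rcons_cat.
exact: leq_addr.
Qed.

Lemma ta_label_inj g h : label g =1 label h -> g = h.
Proof.
move=> gh; apply: tree_aut_ext; elim/last_ind => [|w x IH].
  by rewrite !ta_nil.
by rewrite !ta_rcons IH gh.
Qed.

End TreeAutTheory.

(* The vertices of X^[d] are the words of length at most d, and G(d) consists
   of the permutations of them that preserve the child relation. MathComp
   multiplies permutations left to right, (s * t) w = t (s w), so the group
   below is the opposite of G(d) with its left action; its subgroups, maximal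
   subgroups and commutator subgroup are the same subsets. *)
Definition fin_tree_aut (d : nat) : {set {perm d.-bseq bool}} :=
  [set s : {perm d.-bseq bool} |
    [forall u : d.-bseq bool, forall v : d.-bseq bool,
       child (s u) (s v) == child u v]]%SET.

Lemma fin_tree_autP d (s : {perm d.-bseq bool}) :
  reflect (forall u v : d.-bseq bool, child (s u) (s v) = child u v)
          (s \in fin_tree_aut d).
Proof.
rewrite inE; apply: (iffP forallP) => sP u; last by apply/forallP => v; apply/eqP.
by move=> v; have /forallP/(_ v)/eqP := sP u.
Qed.

Lemma fin_tree_aut_group_set d : group_set (fin_tree_aut d).
Proof.
apply/group_setP; split=> [|s t /fin_tree_autP sP /fin_tree_autP tP].
  by apply/fin_tree_autP => u v; rewrite !perm1.
by apply/fin_tree_autP => u v; rewrite !permM tP sP.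
Qed.

Canonical fin_tree_aut_group d := Group (fin_tree_aut_group_set d).

(* The label of s at a word w; it is meaningful for size w < d, i.e. on X^(d),
   where every word involved has length at most d. *)
Definition plabel (d : nat) (s : {perm d.-bseq bool}) (w : seq bool) : bool :=
  label (fun u => s (insub_bseq d u)) w.

(* The map on words with prescribed labels: it sends the word xu to
   (x + p(empty)) g'(u), where g' has labels p(x -). *)
Fixpoint act_by_labels (p : seq bool -> bool) (u : seq bool) : seq bool :=
  if u is x :: u' then
    (x (+) p [::]) :: act_by_labels (fun v => p (x :: v)) u'
  else [::].

Lemma size_act_by_labels p u : size (act_by_labels p u) = size u.
Proof. by elim: u p => //= x u IH p; rewrite IH. Qed.

Lemma act_by_labels_inj p : injective (act_by_labels p).
Proof.
move=> u; elim: u p => [|x u IH] p [|y v] //= [xy uv].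
have E : x = y by move: xy; case: x y (p [::]) {uv} => [] [] [].
by rewrite E in uv *; rewrite (IH _ _ uv).
Qed.

Lemma act_by_labels_rcons p u x :
  act_by_labels p (rcons u x) = rcons (act_by_labels p u) (x (+) p u).
Proof. by elim: u p => //= y u IH p; rewrite IH. Qed.

Lemma size_act_by_labels_bseq d p (u : d.-bseq bool) :
  size (act_by_labels p u) <= d.
Proof. by rewrite size_act_by_labels size_bseq. Qed.

Definition pattern_fun d p (u : d.-bseq bool) : d.-bseq bool :=
  Bseq (size_act_by_labels_bseq p u).

Lemma pattern_fun_inj d p : injective (@pattern_fun d p).
Proof. by move=> u v /(congr1 val)/act_by_labels_inj/val_inj. Qed.

Definition pattern (d : nat) (p : seq bool -> bool) : {perm d.-bseq bool} :=
  perm (@pattern_fun_inj d p).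

(* The element a_i of G(d), for i < d. *)
Definition agen (d i : nat) : {perm d.-bseq bool} :=
  pattern d (pred1 (nseq i false)).

Lemma pattern_in d p : pattern d p \in fin_tree_aut d.
Proof.
apply/fin_tree_autP => u v; rewrite !permE /=.
apply/childP/childP => -[x].
  case/lastP: (val v) => [|w y]; first by case: (act_by_labels p u).
  rewrite act_by_labels_rcons => /rcons_inj[/act_by_labels_inj <- _].
  by exists y.
by move=> ->; rewrite act_by_labels_rcons; exists (x (+) p u).
Qed.

Lemma plabel_pattern d p w : size w < d -> plabel (pattern d p) w = p w.
Proof.
move=> wd; rewrite /plabel /label /section !permE /=.
have insubE (x : bool) : insub_bseq d (w ++ [:: x]) = rcons w x :> seq bool.
  by rewrite /insub_bseq val_insubd /= size_cat addn1 wd cats1.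
rewrite !insubE !act_by_labels_rcons -!cats1 !drop_size_cat ?size_act_by_labels //.
by case: (p w).
Qed.

(* Essential pattern groups: the two first-level sections of a pattern in P,
   which are patterns of size d-1, extend to patterns in P. *)
Definition essential (d : nat) (P : {set {perm d.-bseq bool}}) : Prop :=
  forall g : {perm d.-bseq bool}, g \in P -> forall x : bool,
    exists2 h : {perm d.-bseq bool}, h \in P &
      forall w : seq bool, size w < d.-1 -> plabel h w = plabel g (x :: w).

Definition fin_constrained (d : nat) (P : {set {perm d.-bseq bool}}) :
    set tree_aut :=
  [set g : tree_aut | forall w : seq bool,
    exists2 p : {perm d.-bseq bool}, p \in P &
      forall v : seq bool, size v < d -> plabel p v = label g (w ++ v)].

Definition left_coset (G : groupType) (H : set G) (g : G) : set G :=
  [set g * h | h in H].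

(* [G : H]; only meaningful when finite, since fset_set sends an infinite set
   to the empty one. *)
Definition grp_index (G : groupType) (H : set G) : nat :=
  #|` fset_set (range (left_coset H))|.

Definition level_stab (n : nat) : set tree_aut :=
  [set g : tree_aut | forall u : seq bool, size u = n -> g u = u].

Definition differ_at (g h : tree_aut) (k : nat) : bool :=
  [exists u : k.-tuple bool, label g u != label h u].

(* Two tree automorphisms are equal exactly when no level separates their
   labels (ta_label_inj). *)
Definition tree_dist (R : realType) (g h : tree_aut) : R :=
  if pselect (exists k, differ_at g h k) is left e
  then ((grp_index (level_stab (ex_minn e)))%:R^-1)%R else 0%R.

Section LevelIndex.
Implicit Types (g h : tree_aut) (m n : nat).

Lemma level_stabM n g h : level_stab n g -> level_stab n h ->
  level_stab n (g * h).
Proof. by move=> gn hn u un; rewrite ta_mulE hn // gn. Qed.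

Lemma level_stabV n g : level_stab n g -> level_stab n g^-1.
Proof.
by move=> gn u un; rewrite -[in LHS](gn u un) -ta_mulE mulVg.
Qed.

Lemma level_stab_le m n : m <= n -> level_stab n `<=` level_stab m.
Proof.
move=> mn g gn u um.
have : g (u ++ nseq (n - m) false) = u ++ nseq (n - m) false.
  by apply: gn; rewrite size_cat size_nseq um subnKC.
rewrite ta_section => /(congr1 (take m)).
by rewrite !take_size_cat ?ta_size.
Qed.

Lemma left_coset_eq n g h :
  (forall u, size u = n -> g u = h u) ->
  left_coset (level_stab n) g = left_coset (level_stab n) h.
Proof.
have half g1 g2 : (forall u, size u = n -> g1 u = g2 u) ->
    left_coset (level_stab n) g1 `<=` left_coset (level_stab n) g2.
  move=> E _ [k kn <-]; exists (g2^-1 * (g1 * k)); last by rewrite mulKVg.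
  move=> u un; rewrite ta_mulE (_ : (g1 * k) u = g2 u).
    by rewrite -ta_mulE mulVg.
  by rewrite ta_mulE kn // E.
by move=> E; apply/seteqP; split; apply: half => // u un; rewrite E.
Qed.

Lemma finite_left_cosets n : finite_set (range (left_coset (level_stab n))).
Proof.
pose F g : {ffun n.-tuple bool -> n.-tuple bool} :=
  [ffun u : n.-tuple bool => insubd u (g u)].
pose psi f := left_coset (level_stab n) (xget (1 : tree_aut) [set g | F g = f]).
apply: (@sub_finite_set _ _ (psi @` [set: _])); last first.
  exact/finite_image/finite_finset.
move=> _ [g _ <-]; exists (F g) => //; apply: left_coset_eq => u un.
case: xgetP => [h _ /= hg|/(_ g) []//].
have FE (k : tree_aut) (t : n.-tuple bool) : tval (F k t) = k t.
  by rewrite ffunE val_insubd ta_size size_tuple eqxx.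
have ut : size u == n by apply/eqP.
by rewrite -[u]/(tval (Tuple ut)) -!FE hg.
Qed.

Lemma level_index_gt0 n : 0 < grp_index (level_stab n).
Proof.
rewrite /grp_index cardfs_gt0; apply/fset0Pn.
exists (left_coset (level_stab n) 1); rewrite in_fset_set.
  by rewrite inE; exists 1.
exact: finite_left_cosets.
Qed.

Lemma level_index_le m n : m <= n ->
  grp_index (level_stab m) <= grp_index (level_stab n).
Proof.
move=> mn; rewrite /grp_index.
pose phi (C : set tree_aut) : set tree_aut :=
  [set c * h | c in C & h in level_stab m].
have -> : range (left_coset (level_stab m)) =
    phi @` range (left_coset (level_stab n)).
  have phiE g : phi (left_coset (level_stab n) g) = left_coset (level_stab m) g.
    apply/seteqP; split=> [_ [_ [k kn <-] [h hm <-]]|_ [h hm <-]].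
      exists (k * h); last by rewrite mulgA.
      by apply: level_stabM => //; exact: (level_stab_le mn).
    exists g; first by exists 1; [move=> u un|rewrite mulg1].
    by exists h.
  rewrite image_comp; congr image; apply/funext => g /=.
  by rewrite phiE.
rewrite fset_set_image; last exact: finite_left_cosets.
exact: leq_imfset_card.
Qed.

End LevelIndex.

Section TreeDist.
Variable R : realType.
Implicit Types g h k : tree_aut.
Local Open Scope ring_scope.

Lemma differ_atC g h : differ_at g h =1 differ_at h g.
Proof. by move=> n; apply: eq_existsb => u; rewrite eq_sym. Qed.

Lemma tree_dist_ge0 g h : 0 <= tree_dist R g h.
Proof. by rewrite /tree_dist; case: pselect => // e; rewrite invr_ge0. Qed.

Lemma tree_distxx g : tree_dist R g g = 0.
Proof.
rewrite /tree_dist; case: pselect => // e; exfalso.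
by case: e => n /existsP[u]; rewrite eqxx.
Qed.

Lemma tree_dist_pos g h : tree_dist R g h = 0 -> g = h.
Proof.
rewrite /tree_dist; case: pselect => [e /eqP|gh _].
  by rewrite invr_eq0 pnatr_eq0 -leqn0 leqNgt level_index_gt0.
apply: ta_label_inj => w; apply/eqP; apply: contra_notT gh => gh.
by exists (size w); apply/existsP; exists (in_tuple w).
Qed.

Lemma tree_dist_sym g h : tree_dist R g h = tree_dist R h g.
Proof.
rewrite /tree_dist.
by rewrite (_ : differ_at g h = differ_at h g) //; apply/funext/differ_atC.
Qed.

Lemma tree_dist_differ g h n : differ_at g h n ->
  ((grp_index (level_stab n))%:R^-1 <= tree_dist R g h).
Proof.
move=> ghn; rewrite /tree_dist; case: pselect => [e|]; last by case; exists n.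
case: ex_minnP => m _ /(_ n ghn) mn.
by rewrite lef_pV2 ?posrE ?ltr0n ?level_index_gt0 // ler_nat level_index_le.
Qed.

Lemma tree_dist_triangle h g k :
  tree_dist R g k <= tree_dist R g h + tree_dist R h k.
Proof.
rewrite {1}/tree_dist; case: pselect => [e|_]; last first.
  by rewrite addr_ge0 ?tree_dist_ge0.
case: ex_minnP => n /existsP[u gku] _.
have [gh|gh] := eqVneq (label g u) (label h u).
  rewrite -[leLHS]add0r lerD ?tree_dist_ge0 // tree_dist_differ //.
  by apply/existsP; exists u; rewrite -gh.
rewrite -[leLHS]addr0 lerD ?tree_dist_ge0 // tree_dist_differ //.
by apply/existsP; exists u.
Qed.

End TreeDist.

(* An alias carrying R: a metricType structure depends on the field of
   distances. *)
Definition tree_space (R : realType) : Type := tree_aut.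

HB.instance Definition _ (R : realType) := Choice.on (tree_space R).
HB.instance Definition _ (R : realType) :=
  @isMetric.Build R (tree_space R) (tree_dist R)
    (@tree_distxx R) (@tree_dist_pos R) (@tree_dist_sym R)
    (@tree_dist_triangle R).

Section Hausdorff.
Context {R : realType} {T : metricType R}.
Implicit Types (A U : set T) (s delta : R).
Local Open Scope ereal_scope.

(* -oo on the empty set, so the empty set is allowed in every cover below. *)
Definition diameter U : \bar R :=
  ereal_sup [set (mdist x y)%:E | x in U & y in U].

(* diam(U)^s, with the empty set costing 0 also when s = 0. *)
Definition diam_pow s U : \bar R :=
  if `[< U = set0 >] then 0 else poweR (diameter U) s.

Definition hausdorff_premeasure s delta A : \bar R :=
  ereal_inf [set \sum_(k <oo) diam_pow s (U k) | U in
    [set U : (set T)^nat | A `<=` \bigcup_k U k /\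
                           forall k, diameter (U k) <= delta%:E]].

Definition hausdorff_measure s A : \bar R :=
  ereal_sup [set hausdorff_premeasure s delta A | delta in
    [set delta : R | (0 < delta)%R]].

Definition hausdorff_dim A : \bar R :=
  ereal_inf [set s%:E | s in
    [set s : R | (0 <= s)%R /\ hausdorff_measure s A = 0]].

End Hausdorff.

(* Main.v *)
Require Import Defs.
From mathcomp Require Import all_boot all_order all_algebra.
From mathcomp Require Import all_fingroup all_solvable finmap.
From mathcomp Require Import all_classical all_reals all_analysis.
From mathcomp Require Import zify ring lra.

(* Write d = e + 1 and let K be the group of the elements of P whose labels all
   vanish above the level e; it is a subgroup of the vector space F_2^(X^e) and
   has 2^r elements, say. Since P is essential, a pattern of size n >= d that is
   allowed by P extends to size n + 1, and its extensions form a coset of one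
   copy of K for each word of length n - e. Hence the number of patterns of size
   n grows like 2^(r 2^(n - e)), all the cylinders of level n have the same
   weight, and the dimension of G_P is r / 2^e.

   The first condition thus says that K is a hyperplane. If so, of two vectors
   outside K the sum is in K, so that every vector on the level e - 1 is the
   section of an element of K; going up the tree, P surjects onto G(e). Therefore
   P has index 2, and, P being transitive on X^e, no single label lies in K.
   Conversely a group containing [G(d), G(d)] contains all the sums of two labels
   on the level e, and if it contains one label of this level then it contains
   them all, hence, going up the tree again, it is G(d). *)

Set Implicit Arguments.
Unset Strict Implicit.
Unset Printing Implicit Defensive.

Import Order.TTheory GRing.Theory Num.Theory.

Local Open Scope nat_scope.

(** * Labelings of the tree and multiplication of patterns *)

Definition agree (n : nat) (p q : seq bool -> bool) : Prop :=
  forall w : seq bool, size w < n -> p w = q w.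

Section Labels.
Implicit Types (p q : seq bool -> bool) (u v w : seq bool) (d n : nat).

Lemma agree_sym n p q : agree n p q -> agree n q p.
Proof. by move=> pq w wn; rewrite pq. Qed.

Lemma agree_trans n q p r : agree n p q -> agree n q r -> agree n p r.
Proof. by move=> pq qr w wn; rewrite pq // qr. Qed.

Lemma agree_le m n p q : m <= n -> agree n p q -> agree m p q.
Proof. by move=> mn pq w wm; apply: pq; apply: leq_trans mn. Qed.

Lemma act_by_labels_agree n p q w : agree n p q -> size w <= n ->
  act_by_labels p w = act_by_labels q w.
Proof.
move=> pq; elim/last_ind: w => // w x IH; rewrite size_rcons => wn.
by rewrite !act_by_labels_rcons IH ?pq // ltnW.
Qed.

Lemma act_by_labels0 w : act_by_labels (fun=> false) w = w.
Proof. by elim: w => //= x w ->; rewrite addbF. Qed.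

Lemma act_by_labels_comp p q w :
  act_by_labels q (act_by_labels p w) =
  act_by_labels (fun v => p v (+) q (act_by_labels p v)) w.
Proof.
elim/last_ind: w => // w x IH.
by rewrite !act_by_labels_rcons IH addbA.
Qed.

(** Labels that depend on the level alone add a fixed word letter by letter; this already suffices
    to carry any word to any other word of the same length. *)
Lemma act_by_labels_levels (f : nat -> bool) w :
  act_by_labels (fun v => f (size v)) w =
  [seq nth false w i (+) f i | i <- iota 0 (size w)].
Proof.
elim: w f => //= x w IH f; congr cons.
rewrite (IH (f \o succn)) (iotaDl 1 0) -map_comp.
by apply: eq_map.
Qed.

Lemma act_by_labels_transitive u v : size u = size v ->
  exists p, act_by_labels p u = v.
Proof.
move=> uv; exists (fun w => nth false u (size w) (+) nth false v (size w)).
rewrite (act_by_labels_levels (fun i => nth false u i (+) nth false v i)).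
rewrite uv -[RHS](mkseq_nth false); apply: eq_map => i.
by rewrite addbA addbb.
Qed.

Lemma pattern_eqP d p q : pattern d p = pattern d q <-> agree d p q.
Proof.
split=> [pq w wd|pq]; first by rewrite -(plabel_pattern p wd) pq plabel_pattern.
apply/permP => u; apply: val_inj; rewrite !permE /=.
exact: (act_by_labels_agree pq (size_bseq u)).
Qed.

Lemma patternM d p q : (pattern d p * pattern d q)%g =
  pattern d (fun w => p w (+) q (act_by_labels p w)).
Proof.
apply/permP => u; apply: val_inj.
by rewrite permM !permE /= act_by_labels_comp.
Qed.

Lemma pattern1 d : pattern d (fun=> false) = 1%g.
Proof.
by apply/permP => u; apply: val_inj; rewrite permE perm1 /= act_by_labels0.
Qed.

(** Induction along the word: preserving the child relation forces [s] to fix the root and to send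
    the two children of [w] to those of its image, in the order told by the label at [w]. *)
Lemma pattern_plabel d (s : {perm d.-bseq bool}) :
  s \in fin_tree_aut d -> pattern d (plabel s) = s.
Proof.
move=> /fin_tree_autP sP.
have insubE w : size w <= d -> insub_bseq d w = w :> seq bool.
  by move=> wd; rewrite /insub_bseq val_insubd wd.
suff H w : size w <= d -> s (insub_bseq d w) = act_by_labels (plabel s) w :>
  seq bool.
  apply/permP => u; apply: val_inj; rewrite permE /= -H ?size_bseq //.
  by congr (val (s _)); apply: val_inj; exact/insubE/size_bseq.
elim/last_ind: w => [_|w x IH].
  (* A nonempty image [rcons v x] of the root would give the root a parent, namely the preimage of
     [v]. *)
  case/lastP E: (val (s (insub_bseq d [::]))) => [//|v x].
  have vd : size v <= d.
    by have := size_bseq (s (insub_bseq d [::])); rewrite E size_rcons => /ltnW.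
  have := child_rcons v x; rewrite -E -{1}(insubE _ vd).
  rewrite -[insub_bseq d v](permKV s) sP.
  by move/child_size; rewrite insubE.
rewrite size_rcons => wd; have wd' := ltnW wd.
have c b : exists y, s (insub_bseq d (rcons w b)) = rcons (s (insub_bseq d w))
  y :> seq bool.
  apply/childP; rewrite sP !insubE ?size_rcons //; exact: child_rcons.
have [y0 g0] := c false; have [y1 g1] := c true.
have y01 : y0 != y1.
  apply/eqP => Ey; have : rcons w false = rcons w true.
    rewrite -(insubE (rcons w false)) ?size_rcons // -(insubE (rcons w true))
      ?size_rcons //.
    by congr val; apply: (@perm_inj _ s); apply: val_inj; rewrite /= g0 g1 Ey.
  by move/rcons_inj => [].
have sz : size (s (insub_bseq d w)) = size w
  by rewrite IH // size_act_by_labels.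
have dE b : drop (size w) (rcons (s (insub_bseq d w)) b) = [:: b].
  by rewrite -cats1 drop_size_cat.
rewrite act_by_labels_rcons -IH // /plabel /label /Defs.section !cats1 g0 g1
  !dE.
by case: x; rewrite ?g0 ?g1; move: y01; clear; case: y0; case: y1.
Qed.

Lemma fin_tree_aut_patternP d (s : {perm d.-bseq bool}) :
  s \in fin_tree_aut d -> exists p, s = pattern d p.
Proof. by move=> /pattern_plabel <-; exists (plabel s). Qed.

(* A factor moving only the last level acts trivially on all the words that
   carry labels, so that the labels add up. *)
Lemma patternM_top e p q : agree e p (fun=> false) ->
  (pattern e.+1 p * pattern e.+1 q)%g = pattern e.+1 (fun w => p w (+) q w).
Proof.
move=> p0; rewrite patternM; apply/pattern_eqP => w we.
by rewrite (act_by_labels_agree p0) ?act_by_labels0.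
Qed.

Lemma patternV_top e p : agree e p (fun=> false) ->
  ((pattern e.+1 p)^-1)%g = pattern e.+1 p.
Proof.
move=> p0; apply/eqP; rewrite eq_invg_mul patternM_top // -pattern1.
by apply/eqP/pattern_eqP => w _; rewrite addbb.
Qed.

Lemma patternJ_delta e q w : size w = e ->
  (pattern e.+1 (pred1 w) ^ pattern e.+1 q)%g =
  pattern e.+1 (pred1 (act_by_labels q w)).
Proof.
move=> we; have w0 : agree e (pred1 w) (fun=> false).
  by move=> x xe; apply/eqP => xv; rewrite xv we ltnn in xe.
(* Multiplying by [pattern e.+1 q] on the left avoids the labels of its inverse. *)
apply: (mulgI (pattern e.+1 q)); rewrite -conjgC (patternM_top _ w0).
rewrite patternM; apply/pattern_eqP => v _ /=.
by rewrite addbC (inj_eq (@act_by_labels_inj q)).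
Qed.

End Labels.

(** * Automorphisms of the infinite tree with prescribed labels *)

Section AutOfLabels.
Implicit Types (p : seq bool -> bool) (w : seq bool).

Lemma act_by_labels_surj p w : exists v, act_by_labels p v = w.
Proof.
elim: w p => [|x w IH] p; first by exists [::].
have [v vE] := IH (fun v => p ((x (+) p [::]) :: v)).
by exists ((x (+) p [::]) :: v); rewrite /= vE -addbA addbb addbF.
Qed.

Lemma act_by_labels_bij p : bijective (act_by_labels p).
Proof.
have [f fK] := choice (act_by_labels_surj p).
by exists f => // w; apply: (@act_by_labels_inj p); rewrite fK.
Qed.

Lemma act_by_labels_child p u v :
  child (act_by_labels p u) (act_by_labels p v) = child u v.
Proof.
apply/childP/childP => -[x].
  case/lastP: v => [|w y]; first by case: (act_by_labels p u).
  rewrite act_by_labels_rcons => /rcons_inj[/act_by_labels_inj <- _].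
  by exists y.
by move=> ->; rewrite act_by_labels_rcons; exists (x (+) p u).
Qed.

Definition aut_of_labels p : tree_aut :=
  TreeAut (act_by_labels_bij p) (act_by_labels_child p).

Lemma label_aut_of_labels p : label (aut_of_labels p) =1 p.
Proof.
move=> w; have := ta_rcons (aut_of_labels p) w false.
by rewrite /= act_by_labels_rcons => /rcons_inj[].
Qed.

End AutOfLabels.

(** * Finite encoding of patterns and their number *)

(* Patterns of size n as a finite type, one component per level. *)
Fixpoint labels_below (n : nat) : finType :=
  if n is m.+1 then (labels_below m * {ffun m.-tuple bool -> bool})%type
  else unit.

Definition set_level (m : nat) (p : seq bool -> bool)
    (u : {ffun m.-tuple bool -> bool}) (w : seq bool) : bool :=
  if insub w is Some t then u t else p w.

Fixpoint trunc (n : nat) (p : seq bool -> bool) : labels_below n :=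
  if n is m.+1 return labels_below n
  then (trunc m p, [ffun t : m.-tuple bool => p t]) else tt.

Fixpoint extend (n : nat) : labels_below n -> seq bool -> bool :=
  if n is m.+1 return labels_below n -> seq bool -> bool
  then fun a => set_level (extend a.1) a.2 else fun _ _ => false.

Section Truncation.
Implicit Types (p q : seq bool -> bool) (w : seq bool) (m n : nat).

Lemma set_levelE m p (u : {ffun m.-tuple bool -> bool}) (t : m.-tuple bool) :
  set_level p u t = u t.
Proof. by rewrite /set_level valK. Qed.

Lemma set_level_other m p (u : {ffun m.-tuple bool -> bool}) w :
  size w != m -> set_level p u w = p w.
Proof. by move=> wm; rewrite /set_level insubN. Qed.

Lemma set_level_agree m p (u : {ffun m.-tuple bool -> bool}) :
  agree m (set_level p u) p.
Proof. by move=> w wm; rewrite set_level_other // ltn_eqF. Qed.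

Lemma pattern_set_level e p q : agree e p q ->
  pattern e.+1 (set_level p [ffun t : e.-tuple bool => q t]) = pattern e.+1 q.
Proof.
move=> pq; apply/pattern_eqP => w; rewrite ltnS leq_eqVlt => /orP[we|we].
  by rewrite -[w]/(tval (Tuple we)) set_levelE ffunE.
by rewrite set_level_agree // pq.
Qed.

Lemma trunc_eqP n p q : trunc n p = trunc n q <-> agree n p q.
Proof.
elim: n => [|n IH] /=; first by split.
split=> [[/IH pq /ffunP pqn] w|pq].
  rewrite ltnS leq_eqVlt => /orP[/eqP wn|]; last exact: pq.
  have wP : size w == n by apply/eqP.
  by have := pqn (Tuple wP); rewrite !ffunE.
congr pair; first by apply/IH; apply: agree_le pq.
by apply/ffunP => t; rewrite !ffunE pq // size_tuple.
Qed.

Lemma extend_trunc n p : agree n (extend (trunc n p)) p.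
Proof.
elim: n => [|n IH] // w /=; rewrite ltnS leq_eqVlt => /orP[/eqP wn|wn].
  have wP : size w == n by apply/eqP.
  by rewrite -[w]/(tval (Tuple wP)) set_levelE ffunE.
by rewrite set_level_agree // IH.
Qed.

Lemma trunc_extend n (a : labels_below n) : trunc n (extend a) = a.
Proof.
elim: n a => [|n IH] /= [] // a u; congr pair.
  by rewrite -[RHS]IH; apply/trunc_eqP/set_level_agree.
by apply/ffunP => t; rewrite ffunE set_levelE.
Qed.

Lemma card_labels_below n : #|labels_below n| = 2 ^ (2 ^ n - 1).
Proof.
elim: n => [|n IH]; first by rewrite card_unit.
rewrite /= card_prod IH card_ffun card_bool card_tuple card_bool -expnD.
by rewrite expnS mul2n -addnn addnBAC ?expn_gt0.
Qed.

Lemma card_fin_tree_aut d : #|fin_tree_aut d| = 2 ^ (2 ^ d - 1).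
Proof.
rewrite -card_labels_below.
have <- : [set pattern d (extend a) | a : labels_below d]%SET = fin_tree_aut d.
  apply/setP => s; apply/imsetP/idP => [[a _ ->]|/fin_tree_aut_patternP[p ->]].
    exact: pattern_in.
  exists (trunc d p) => //; apply/pattern_eqP; exact/agree_sym/extend_trunc.
rewrite card_imset ?cardsT // => a b /pattern_eqP/trunc_eqP.
by rewrite !trunc_extend.
Qed.

End Truncation.

(** * The kernel on the last level and surjectivity onto shorter patterns *)

Section PatternGroup.
Variables (e : nat) (P : {group {perm e.+1.-bseq bool}}).
Implicit Types (p q : seq bool -> bool) (u v : {ffun e.-tuple bool -> bool}).

(** The group K of the overview, recorded additively as a set of vectors over the two-element field
    indexed by the words of length [e]. *)
Definition top_kernel : {set {ffun e.-tuple bool -> bool}} :=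
  [set u | pattern e.+1 (set_level (fun=> false) u) \in P]%SET.

(** For [m <= e.+1]: the restriction of [p] lies in the image of [P] in G(m). *)
Definition extendable (m : nat) (p : seq bool -> bool) : Prop :=
  exists2 q, pattern e.+1 q \in P & agree m p q.

(** For [m <= e]: the image of [P] in G(m+1) contains every pattern supported on level [m]. *)
Definition level_full (m : nat) : Prop :=
  forall p, agree m p (fun=> false) -> extendable m.+1 p.

Lemma pattern_set_levelM p u v :
  (pattern e.+1 (set_level (fun=> false) u) * pattern e.+1 (set_level p v) =
   pattern e.+1 (set_level p (u + v)%R))%g.
Proof.
rewrite patternM_top; last exact: set_level_agree.
apply/pattern_eqP => w; rewrite ltnS leq_eqVlt => /orP[we|we].
  by rewrite -[w]/(tval (Tuple we)) !set_levelE ffunE.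
by rewrite !set_level_agree.
Qed.

Lemma sum_deltas u : u = (\sum_(t | u t) [ffun x => x == t])%R.
Proof.
apply/ffunP => x; rewrite sum_ffunE.
have [ux|ux] := boolP (u x).
  rewrite (bigD1 x) //= ffunE eqxx big1 => [//|t /andP[_ tx]].
  by rewrite ffunE eq_sym (negbTE tx).
rewrite big1 ?(negbTE ux) // => t ut; rewrite ffunE.
by case: eqP ut ux => // -> ->.
Qed.

Lemma addffbb u : (u + u)%R = 0%R.
Proof. by apply/ffunP => t; rewrite !ffunE; case: (u t). Qed.

Lemma addffKb u v : (u + v + v)%R = u.
Proof. by rewrite -addrA addffbb addr0. Qed.

(** Left multiplication by a pattern trivial above the last level adds vectors there, so the
    elements of [P] over a given restriction, if any, form a coset of the kernel. *)
Lemma pattern_coset p u v : pattern e.+1 (set_level p v) \in P ->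
  (pattern e.+1 (set_level p u) \in P) = ((u + v)%R \in top_kernel).
Proof.
move=> vP; rewrite inE -[in RHS](groupMr _ vP) pattern_set_levelM.
by rewrite addffKb.
Qed.

Lemma top_kernel0 : 0%R \in top_kernel.
Proof.
rewrite inE (_ : pattern _ _ = 1%g) ?group1 // -pattern1;
  apply/pattern_eqP => w _.
by rewrite /set_level; case: insub => // t; rewrite ffunE.
Qed.

Lemma top_kernelD u v : v \in top_kernel ->
  ((u + v)%R \in top_kernel) = (u \in top_kernel).
Proof. by rewrite inE => vP; rewrite -(pattern_coset _ vP) inE. Qed.

Lemma card_pattern_fiber p v : pattern e.+1 (set_level p v) \in P ->
  #|[set u : {ffun e.-tuple bool -> bool} |
     pattern e.+1 (set_level p u) \in P]%SET| = #|top_kernel|.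
Proof.
move=> vP; rewrite -(card_imset _ (@addIr _ v)); apply: eq_card => u.
apply/imsetP/idP => [[x]|uK].
  by rewrite inE => xP ->; rewrite -(pattern_coset _ vP).
exists (u + v)%R; last by rewrite addffKb.
by rewrite inE (pattern_coset _ vP) addffKb.
Qed.

(** The kernel embeds in the 2-group G(d), and Lagrange's theorem applies. *)
Lemma card_top_kernel : exists r, #|top_kernel| = 2 ^ r.
Proof.
pose f u := pattern e.+1 (set_level (fun=> false) u).
have f_inj : injective f.
  move=> u v /pattern_eqP uv; apply/ffunP => t.
  by have := uv t; rewrite !set_levelE size_tuple; apply.
have gK : group_set (f @: top_kernel).
  apply/group_setP; split.
    apply/imsetP; exists 0%R; first exact: top_kernel0.
    rewrite -pattern1; apply/pattern_eqP => w _.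
    by rewrite /set_level; case: insub => // t; rewrite ffunE.
  move=> _ _ /imsetP[u uK ->] /imsetP[v vK ->].
  by rewrite pattern_set_levelM; apply: imset_f; rewrite top_kernelD.
have : #|Group gK| %| #|fin_tree_aut e.+1|.
  by apply: cardSg; apply/fintype.subsetP => _ /imsetP[u _ ->];
    apply: pattern_in.
rewrite card_fin_tree_aut card_imset // => /dvdn_pfactor[] // r _ ->.
by exists r.
Qed.

(** Level by level: once the labels of [p] are realized below level [m], an element trivial above
    level [m] corrects them on that level. *)
Lemma extendable_full m : (forall j, j < m -> level_full j) ->
  forall p, extendable m p.
Proof.
elim: m => [|m IH] full p; first by exists (fun=> false); rewrite ?pattern1.
have [q qP pq] := IH (fun j jm => full j (ltnW jm)) p.
(* The error that remains on level [m]. *)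
pose h w := (size w == m) && (p w (+) q w).
have h0 : agree m h (fun=> false) by move=> w wm; rewrite /h ltn_eqF.
have [h' hP hh'] := full m (ltnSn m) h h0.
exists (fun w => h' w (+) q (act_by_labels h' w));
  first by rewrite -patternM groupM.
move=> w wm; rewrite (act_by_labels_agree (q := fun=> false) (n := m)) //.
  rewrite act_by_labels0 -hh' // /h; move: wm; rewrite ltnS leq_eqVlt.
  by case: eqP => [_ _|_ /= /pq //]; rewrite -addbA addbb addbF.
by apply: agree_trans h0; apply: agree_le (agree_sym hh').
Qed.

Lemma top_kernel_deltas :
  (forall t, [ffun x => x == t] \in top_kernel) -> forall u, u \in top_kernel.
Proof.
move=> dK u.
rewrite (sum_deltas u).
elim/big_rec: _ => [|t v _ vK]; first exact: top_kernel0.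
by rewrite top_kernelD.
Qed.

Hypothesis P_sub : P \subset fin_tree_aut e.+1.

Lemma memP_pattern s : s \in P -> s = pattern e.+1 (plabel s).
Proof. by move=> sP; rewrite pattern_plabel // (fintype.subsetP P_sub). Qed.

Lemma card_group_patterns :
  #|P| = #|[set a : labels_below e.+1 | pattern e.+1 (extend a) \in P]%SET|.
Proof.
pose f (a : labels_below e.+1) := pattern e.+1 (extend a).
have f_inj : injective f.
  by move=> a b /pattern_eqP/trunc_eqP; rewrite !trunc_extend.
rewrite -(card_imset _ f_inj); apply: eq_card => s.
apply/idP/imsetP => [sP|[a]]; last by rewrite inE => aP ->.
have sE : s = f (trunc e.+1 (plabel s)).
  by rewrite [LHS]memP_pattern //; apply/pattern_eqP/agree_sym/extend_trunc.
by exists (trunc e.+1 (plabel s)); rewrite // inE -[pattern _ _]sE.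
Qed.

Lemma card_full_patterns : (forall p, extendable e p) ->
  #|P| = #|labels_below e| * #|top_kernel|.
Proof.
move=> full; pose f (a : labels_below e.+1) := pattern e.+1 (extend a).
rewrite card_group_patterns.
rewrite -sum1dep_card (eq_bigl (fun a => true && (f (a.1, a.2) \in P)));
  last by case.
rewrite -(pair_big_dep xpredT (fun a u => f (a, u) \in P) (fun _ _ => 1)) /=.
rewrite -sum_nat_const; apply: eq_bigr => a _; rewrite sum1dep_card.
(* Surjectivity provides a point of each fibre, which is then a coset of the kernel. *)
have [q qP aq] := full (extend a).
apply: (@card_pattern_fiber (extend a) [ffun t : e.-tuple bool => q t]).
by rewrite pattern_set_level.
Qed.

Hypothesis P_ess : essential P.

Lemma essential_pattern q x : pattern e.+1 q \in P ->
  exists2 h, pattern e.+1 h \in P & agree e h (fun w => q (x :: w)).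
Proof.
move=> qP; have [s sP sE] := P_ess qP x.
exists (plabel s); first by rewrite -memP_pattern.
by move=> w we; rewrite sE // plabel_pattern.
Qed.

(** A vector on level [m] is placed in the subtree at the letter 0, where it sits on level [m.+1];
    essentiality brings the section at 0 back into [P]. *)
Lemma level_full_pred m : m.+1 <= e -> level_full m.+1 -> level_full m.
Proof.
move=> me full p p0.
have [|q qP pq] := full (fun w => if w is false :: w' then p w' else false).
  by move=> [|[] w] //= wm; rewrite p0.
have [h hP hq] := essential_pattern false qP.
exists h => // w wm; rewrite hq; last exact: leq_trans wm me.
by rewrite -pq.
Qed.

Lemma level_full_extendable m p : m <= e -> level_full m -> extendable m.+1 p.
Proof.
move=> me full; apply: extendable_full => j.
rewrite ltnS => jm; rewrite -(subKn jm).
(* Descending induction on the level, written as [m - k]; once [k] reaches [m], truncated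
   subtraction makes the step trivial. *)
elim: (m - j) => [|k IH]; first by rewrite subn0.
have [mk|km] := leqP m k.
  by move: IH; rewrite (_ : m - k.+1 = m - k) //; lia.
apply: level_full_pred; first by lia.
by rewrite (_ : (m - k.+1).+1 = m - k) //; lia.
Qed.

Lemma top_kernel_full : (forall u, u \in top_kernel) ->
  fin_tree_aut e.+1 \subset P.
Proof.
move=> Kfull; apply/fintype.subsetP => s /fin_tree_aut_patternP[p ->].
have [|q qP pq] := @level_full_extendable e p (leqnn e); last first.
  by rewrite (_ : pattern _ p = pattern _ q) //; apply/pattern_eqP.
move=> q q0; exists q => //.
have := Kfull [ffun t : e.-tuple bool => q t].
by rewrite inE pattern_set_level //; exact: agree_sym.
Qed.

End PatternGroup.

(** * Pattern groups whose kernel is a hyperplane *)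

Section HalfKernel.
Variables (e : nat) (P : {group {perm e.+1.-bseq bool}}).
Implicit Types (p q : seq bool -> bool) (u v : {ffun e.-tuple bool -> bool}).
Hypotheses (P_sub : P \subset fin_tree_aut e.+1) (P_ess : essential P).

Local Notation K := (top_kernel P).
Local Notation delta t := [ffun x : e.-tuple bool => x == t].

Lemma card_level : #|{ffun e.-tuple bool -> bool}| = 2 ^ 2 ^ e.
Proof. by rewrite card_ffun card_bool card_tuple card_bool. Qed.

(** The kernel and its translate by [u] are disjoint and together fill the space, so [v] lies in the
    translate. *)
Lemma half_kernelD u v : #|K|.*2 = 2 ^ 2 ^ e ->
  u \notin K -> v \notin K -> (u + v)%R \in K.
Proof.
move=> half uK vK.
set S := [set (u + x)%R | x in K]%SET.
have dis : [disjoint K & S].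
  rewrite disjoint_sym finset.disjoints_subset.
  apply/fintype.subsetP => _ /imsetP[x xK ->].
  by rewrite inE top_kernelD.
have KS : #|K :|: S| = #|{ffun e.-tuple bool -> bool}|.
  apply/eqP; move: dis; rewrite -(leq_card_setU K S) => /eqP ->.
  by rewrite card_imset ?addnn ?half ?card_level //; exact: addrI.
have : v \in K :|: S.
  by rewrite (elimT (subset_cardP KS) (subset_predT _)).
rewrite inE (negbTE vK) => /imsetP[x xK ->].
by rewrite addrA addffbb add0r.
Qed.

Lemma half_level_full e' : e = e'.+1 -> #|K|.*2 = 2 ^ 2 ^ e -> level_full P e'.
Proof.
move=> ee half p p0.
(* [U x] is the copy of [p] in the subtree at [x]. If neither copy lies in K, their sum does, and
   its section at 0 is still [p] on this level. *)
pose U x : {ffun e.-tuple bool -> bool} :=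
  [ffun t : e.-tuple bool => if tval t is y :: w then (y == x) && p w else
    false].
have H x u : (forall w, size w = e' ->
  set_level (fun=> false) u (x :: w) = p w) ->
    u \in K -> extendable P e'.+1 p.
  move=> up uK; rewrite inE in uK.
  have [h hP hu] := essential_pattern P_sub P_ess x uK.
  exists h => // w we; rewrite hu ?ee //.
  move: we; rewrite ltnS leq_eqVlt => /orP[/eqP/up //|we].
  by rewrite set_level_agree ?p0 // ee.
have level (u : {ffun e.-tuple bool -> bool}) x w (xw : size (x :: w) == e) :
    set_level (fun=> false) u (x :: w) = u (Tuple xw).
  exact: (set_levelE _ u (Tuple xw)).
have [U0|U0] := boolP (U false \in K).
  apply: (H false _ _ U0) => w we;
    have xw : size (false :: w) == e by rewrite ee /= we.
  by rewrite level ffunE.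
have [U1|U1] := boolP (U true \in K).
  apply: (H true _ _ U1) => w we;
    have xw : size (true :: w) == e by rewrite ee /= we.
  by rewrite level ffunE.
apply: (H false _ _ (half_kernelD half U0 U1)) => w we.
have xw : size (false :: w) == e by rewrite ee /= we.
by rewrite level !ffunE addr0.
Qed.

Lemma half_extendable p : #|K|.*2 = 2 ^ 2 ^ e -> extendable P e p.
Proof.
move=> half; have [e0|e0] := posnP e.
  by exists (fun=> false); rewrite ?pattern1 // => w; rewrite e0.
have := @level_full_extendable e P P_sub P_ess e.-1 p (leq_pred e).
rewrite prednK //; apply.
by apply: half_level_full => //; rewrite prednK.
Qed.

Lemma half_index : #|K|.*2 = 2 ^ 2 ^ e -> #|fin_tree_aut e.+1 : P|%g = 2.
Proof.
move=> half; rewrite -divgS // card_fin_tree_aut (card_full_patterns P_sub);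
  last first.
  by move=> p; apply: half_extendable.
have -> : 2 ^ (2 ^ e.+1 - 1) = 2 * (#|labels_below e| * #|K|).
  rewrite mulnCA [2 * _]mul2n half card_labels_below -expnD.
  by rewrite expnS mul2n -addnn addnBAC ?expn_gt0.
rewrite mulnK // muln_gt0 card_labels_below expn_gt0 /=.
by rewrite -double_gt0 half expn_gt0.
Qed.

Lemma delta_kernel w (we : size w == e) :
  (delta (Tuple we) \in K) = (pattern e.+1 (pred1 w) \in P).
Proof.
rewrite inE; congr (_ \in P); apply/pattern_eqP => x _ /=.
have [xe|xe] := eqVneq (size x) e.
  move/eqP: (xe) => xe'; rewrite -[x]/(tval (Tuple xe')) set_levelE ffunE.
  exact: val_eqE.
by rewrite set_level_other //; apply/esym/eqP => xw; rewrite xw we in xe.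
Qed.

(** Since [P] surjects onto G(e), it is transitive on the words of length [e]; conjugation would
    spread a single label of the kernel over the whole level, and the kernel would be everything. *)
Lemma half_agen : #|K|.*2 = 2 ^ 2 ^ e -> agen e.+1 e \notin P.
Proof.
move=> half; apply/negP => aP.
have : #|K| = 2 ^ 2 ^ e.
  rewrite -card_level; apply: eq_card => u; rewrite [RHS]inE.
  apply: top_kernel_deltas => t; case: t => w we; rewrite delta_kernel.
  have [|q qw] := @act_by_labels_transitive (nseq e false) w.
    by rewrite size_nseq (eqP we).
  (* The image of a word of length [e] depends only on labels above level [e], where [q] can be
     matched inside [P]. *)
  have [q' q'P qq'] := half_extendable q half.
  rewrite -qw (act_by_labels_agree qq') ?size_nseq // -patternJ_delta
    ?size_nseq //.
  by rewrite groupJr.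
move: half; rewrite -addnn => half K2; move: half; rewrite K2 => /eqP.
by rewrite -[X in _ == X]addn0 eqn_add2l expn_eq0.
Qed.

Lemma half_maximal : #|K|.*2 = 2 ^ 2 ^ e -> maximal P (fin_tree_aut e.+1).
Proof.
by move=> half; apply: p_index_maximal; rewrite ?half_index.
Qed.

(** In a 2-group a maximal subgroup is normal of index 2, so the quotient is cyclic, hence
    abelian. *)
Lemma maximal_der : maximal P (fin_tree_aut e.+1) ->
  P \proper fin_tree_aut e.+1 /\
  [~: fin_tree_aut e.+1, fin_tree_aut e.+1]%g \subset P.
Proof.
move=> maxP; split; first exact: maxgroupp maxP.
have pG : (2.-group (fin_tree_aut e.+1))%g.
  by rewrite /pgroup card_fin_tree_aut pnatX.
have nP := p_maximal_normal pG maxP.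
rewrite -derg1; apply: der1_min; first exact: normal_norm.
apply/cyclic_abelian/prime_cyclic; rewrite card_quotient ?normal_norm //.
by rewrite (p_maximal_index pG maxP).
Qed.

Lemma der_half : P \proper fin_tree_aut e.+1 ->
  [~: fin_tree_aut e.+1, fin_tree_aut e.+1]%g \subset P ->
  #|K|.*2 = 2 ^ 2 ^ e.
Proof.
move=> /properP[_ [s sG sP]] /fintype.subsetP derP.
(* The commutator of the label at [t] with an element moving [t] to [t'] is the sum of the labels at
   [t] and [t']. *)
have pair (t t' : e.-tuple bool) : (delta t + delta t')%R \in K.
  have [q qt] : exists q, act_by_labels q t = t'.
    by apply: act_by_labels_transitive; rewrite !size_tuple.
  have : ([~ pattern e.+1 (pred1 (tval t)), pattern e.+1 q])%g \in P.
    by apply: derP; apply: mem_commg; apply: pattern_in.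
  rewrite commgEl patternJ_delta ?size_tuple // qt.
  have t0 : agree e (pred1 (tval t)) (fun=> false).
    by move=> x xe; apply/eqP => xt; rewrite xt size_tuple ltnn in xe.
  rewrite patternV_top // patternM_top // inE; congr (_ \in P).
  apply/pattern_eqP => x _ /=.
  have [xe|xe] := eqVneq (size x) e.
    move/eqP: (xe) => xe'; rewrite -[x]/(tval (Tuple xe')) set_levelE !ffunE.
    by rewrite -!val_eqE.
  rewrite set_level_other //.
  by do 2![case: eqP => [xt|_]; first by rewrite xt size_tuple eqxx in xe].
pose t0 := nseq_tuple e false.
(* Otherwise the pairs would put every single label in K, and [P] would be all of G(d). *)
have d0 : delta t0 \notin K.
  apply: contra sP => dK; apply: (fintype.subsetP (top_kernel_full P_sub P_ess
    _)) => //.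
  apply: top_kernel_deltas => t.
  by rewrite -(top_kernelD _ dK) pair.
(* The parity of the number of labels decides which of the two cosets [u] is in. *)
have parity u : u \in K \/ (u + delta t0)%R \in K.
  rewrite (sum_deltas u).
  elim/big_rec: _ => [|t v _ [vK|vK]]; first by left; exact: top_kernel0.
    by right; rewrite addrAC top_kernelD // pair.
  left; have -> : (delta t + v = delta t + delta t0 + (v + delta t0))%R.
    by rewrite addrACA addffbb addr0.
  by rewrite top_kernelD // pair.
set S := (fun u => (u + delta t0)%R) @: K.
have KS : #|K :|: S| = #|{ffun e.-tuple bool -> bool}|.
  apply: eq_card => u; rewrite [RHS]inE inE.
  case: (parity u) => uK; apply/orP; [by left|right].
  by apply/imsetP; exists (u + delta t0)%R; rewrite ?addffKb.
rewrite -card_level -KS -addnn.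
have /eqP -> : #|K :|: S| == #|K| + #|S|.
  rewrite (leq_card_setU K S) disjoint_sym finset.disjoints_subset.
  apply/fintype.subsetP => _ /imsetP[x xK ->].
  by rewrite inE addrC top_kernelD.
by rewrite card_imset //; exact: addIr.
Qed.

End HalfKernel.

(** * Counting the allowed patterns of each size *)

Section Counting.
Variables (e : nat) (P : {group {perm e.+1.-bseq bool}}).
Implicit Types (p q : seq bool -> bool).
Hypotheses (P_sub : P \subset fin_tree_aut e.+1) (P_ess : essential P).

(** Only windows that fit in the first [n] levels are tested, so the condition is empty for
    [n <= e]. *)
Definition allowed (n : nat) (p : seq bool -> bool) : Prop :=
  forall w : seq bool, size w + e.+1 <= n ->
    pattern e.+1 (fun v => p (w ++ v)) \in P.

Definition patterns (n : nat) : {set labels_below n} :=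
  [set a | `[< allowed n (extend a) >]]%SET.

Lemma fin_constrainedP (g : tree_aut) :
  fin_constrained P g <-> forall n, allowed n (label g).
Proof.
split=> [gP n w _|gP w].
  have [s sP sg] := gP w; rewrite (_ : pattern _ _ = s) //.
  rewrite [RHS](memP_pattern P_sub sP); apply/pattern_eqP => v vd.
  by rewrite sg.
(* The window at [w] is tested at the size [size w + e.+1]. *)
exists (pattern e.+1 (fun v => label g (w ++ v))); first exact: gP (leqnn _).
by move=> v vd; rewrite plabel_pattern.
Qed.

Lemma allowed_agree n p q : agree n p q -> allowed n p -> allowed n q.
Proof.
move=> pq pP w wn; rewrite (_ : pattern _ _ = pattern e.+1 (fun v => p (w ++
  v))).
  exact: pP.
apply/pattern_eqP => v ve; apply/esym/pq; rewrite size_cat.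
by apply: leq_trans wn; rewrite ltn_add2l.
Qed.

Lemma allowed_le m n p : m <= n -> allowed n p -> allowed m p.
Proof. by move=> mn pP w wm; apply: pP; apply: leq_trans mn. Qed.

Lemma trunc_patterns n p : (trunc n p \in patterns n) <-> allowed n p.
Proof.
rewrite inE; split=> [/asboolP|pP]; last apply/asboolP.
  exact/allowed_agree/extend_trunc.
exact/(allowed_agree _ pP)/agree_sym/extend_trunc.
Qed.

Lemma patternsP n (a : labels_below n) : reflect (allowed n (extend a)) (a \in
  patterns n).
Proof. by rewrite inE; exact: asboolP. Qed.

Lemma patterns_gt0 n : 0 < #|patterns n|.
Proof.
apply/card_gt0P; exists (trunc n (fun=> false)); apply/trunc_patterns => w _.
by rewrite pattern1.
Qed.

(** Cuts level [m + e] into the last levels of the windows rooted at the words of length [m]. *)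
Let block m (u : {ffun (m + e).-tuple bool -> bool}) :
    {ffun m.-tuple bool -> {ffun e.-tuple bool -> bool}} :=
  [ffun w : m.-tuple bool => [ffun t : e.-tuple bool => u [tuple of w ++ t]]].

Let block_inj m : injective (@block m).
Proof.
move=> u v uv; apply/ffunP => t.
have tm : size (take m t) == m.
  by rewrite size_take size_tuple; case: ltnP => //;
    rewrite -{2}[m]addn0 leq_add2l leqn0 => /eqP ->; rewrite addn0.
have te : size (drop m t) == e by rewrite size_drop size_tuple addKn.
have /ffunP/(_ (Tuple tm))/ffunP/(_ (Tuple te)) := uv; rewrite !ffunE.
by rewrite (_ : [tuple of _] = t) //; apply: val_inj; rewrite /= cat_take_drop.
Qed.

(** The windows rooted above level [m] already lie inside [b], so only those rooted on level [m]
    bring new conditions, and these are independent of one another. *)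
Lemma patterns_blockP m (b : labels_below (m + e)) u : b \in patterns (m + e) ->
  ((b, u) \in patterns (m + e).+1) =
  [forall w : m.-tuple bool,
    pattern e.+1 (set_level (fun x => extend b (w ++ x)) (block u w)) \in P].
Proof.
move=> /patternsP bP; have key (w : m.-tuple bool) :
    pattern e.+1 (fun x => set_level (extend b) u (w ++ x)) =
    pattern e.+1 (set_level (fun x => extend b (w ++ x)) (block u w)).
  apply/pattern_eqP => x; rewrite ltnS leq_eqVlt => /orP[xe|xe].
    rewrite -[x]/(tval (Tuple xe)) set_levelE !ffunE.
    exact: (set_levelE _ u [tuple of w ++ Tuple xe]).
  by rewrite !set_level_agree // size_cat size_tuple ltn_add2l.
apply/patternsP/forallP => [uP w|uP w].
  by rewrite -key; apply: uP; rewrite size_tuple addnS.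
rewrite addnS ltnS leq_add2r leq_eqVlt => /orP[wm|wm].
  by rewrite -[w]/(tval (Tuple wm)) key.
apply: allowed_agree bP _ _; last by rewrite addnS -addSn leq_add2r.
exact/agree_sym/set_level_agree.
Qed.

(** The extensions form a product over the words of length [m.+1]. Each factor is nonempty, because
    the window at the parent is in [P] and essentiality extends its section; it is therefore a coset
    of the kernel. *)
Lemma card_patterns_fiber m (b : labels_below (m.+1 + e)) :
  b \in patterns (m.+1 + e) ->
  #|[set u | (b, u) \in patterns (m.+1 + e).+1]%SET| = #|top_kernel P| ^ 2 ^
    m.+1.
Proof.
move=> bP; pose E (w : m.+1.-tuple bool) := [set v : {ffun e.-tuple bool ->
  bool} |
   pattern e.+1 (set_level (fun x => extend b (w ++ x)) v) \in P]%SET.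
rewrite -(card_imset _ (@block_inj m.+1)).
have -> : #|@block m.+1 @: [set u | (b, u) \in patterns (m.+1 + e).+1]%SET| =
    #|family (fun w => mem (E w))|.
  apply: eq_card => f; apply/imsetP/familyP => [[u + -> w]|fE].
    by rewrite inE patterns_blockP // => /forallP; rewrite inE.
  (* Glues the blocks together; both pieces have the right length, so the defaults are never
     taken. *)
  pose u : {ffun (m.+1 + e).-tuple bool -> bool} :=
    [ffun t : (m.+1 + e).-tuple bool =>
      f (insubd (nseq_tuple _ false) (take m.+1 t)) (insubd (nseq_tuple _
        false) (drop m.+1 t))].
  have fu : f = block u.
    apply/ffunP => w; apply/ffunP => t; rewrite !ffunE.
    rewrite take_size_cat ?size_tuple // drop_size_cat ?size_tuple //.
    by rewrite !valKd.
  exists u => //; rewrite inE patterns_blockP //; apply/forallP => w.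
  by have := fE w; rewrite inE -fu.
rewrite card_family foldrE big_image /=.
rewrite (eq_bigr (fun=> #|top_kernel P|)); last first.
  move=> w _; case/lastP wE : (tval w) => [|w' x].
    by have := size_tuple w; rewrite wE.
  have sw' : size w' = m by have := size_tuple w; rewrite wE size_rcons => -[].
  have [|h hP hE] := @essential_pattern e P P_sub P_ess (fun y => extend b (w'
    ++ y)) x.
    by move/patternsP: bP; apply; rewrite sw' addSn addnS.
  apply: (@card_pattern_fiber _ _ _ [ffun t : e.-tuple bool => h t]).
  rewrite pattern_set_level // => y ye.
  by rewrite hE // wE cat_rcons.
by rewrite prod_nat_const card_tuple card_bool.
Qed.

(** The predicate [Q] lets the same step count all patterns and those of a cylinder. *)
Lemma card_patterns_step m (Q : pred (labels_below (m.+1 + e))) :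
  #|[set b in patterns (m.+1 + e).+1 | Q b.1]%SET| =
  #|[set b in patterns (m.+1 + e) | Q b]%SET| * #|top_kernel P| ^ 2 ^ m.+1.
Proof.
rewrite -sum1dep_card (eq_bigl (fun b : labels_below (m.+1 + e).+1 =>
    Q b.1 && ((b.1, b.2) \in patterns (m.+1 + e).+1))); last first.
  by case=> a u /=; rewrite andbC.
rewrite -(pair_big_dep Q (fun a u => (a, u) \in patterns (m.+1 + e).+1) (fun _
  _ => 1)) /=.
rewrite -sum_nat_const big_mkcond /= [RHS]big_mkcond /=; apply: eq_bigr => a _.
rewrite inE andbC; case: (Q a) => //=.
case: ifPn => [aP|aP]; first by rewrite sum1dep_card card_patterns_fiber.
apply: big1 => u /(elimT (@patternsP (m.+1 + e).+1 (a, u))) uP; case/negP: aP.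
apply/(@patternsP (m.+1 + e) a).
apply: (allowed_agree (p := extend ((a, u) : labels_below (m.+1 + e).+1))).
  exact: set_level_agree.
exact: allowed_le uP.
Qed.

Lemma card_patterns1 : #|patterns (1 + e)| = #|P|.
Proof.
rewrite (card_group_patterns P_sub); apply: eq_card => a; rewrite [RHS]inE.
apply/patternsP/idP => [aP|aP w]; first exact: aP [::] _.
by rewrite -[X in _ <= X]add0n leq_add2r leqn0 size_eq0 => /eqP ->.
Qed.

Lemma card_patternsS m :
  #|patterns (m.+1 + e).+1| = #|patterns (m.+1 + e)| * #|top_kernel P| ^ 2 ^
    m.+1.
Proof.
have := card_patterns_step (m := m) xpredT.
by congr (_ = _ * _); apply: eq_card => b; rewrite inE andbT.
Qed.

(** The exponents 2, 4, ..., 2^m add up to 2^(m+1) - 2; the square on the left avoids the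
    subtraction. *)
Lemma card_patterns m : #|patterns (m.+1 + e)| * #|top_kernel P| ^ 2 =
  #|P| * #|top_kernel P| ^ 2 ^ m.+1.
Proof.
elim: m => [|m IH]; first by rewrite card_patterns1.
rewrite addSn card_patternsS mulnAC IH -mulnA -expnD; congr (_ * _ ^ _).
by rewrite [RHS]expnS mul2n addnn.
Qed.

Definition cylinder (n N : nat) (p : seq bool -> bool) : {set labels_below N} :=
  [set b in patterns N | `[< agree n (extend b) p >]]%SET.

(** From level [n] on, each new level multiplies both counts by the same factor, and at level [n]
    the cylinder has at most one element. *)
Lemma card_cylinder n N p : e < n -> n <= N ->
  #|cylinder n N p| * #|patterns n| <= #|patterns N|.
Proof.
move=> en /subnKC <-; elim: (N - n) => [|k IH].
  rewrite addn0 -[leqRHS]mul1n leq_mul2r; apply/orP; right.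
  rewrite -(cards1 (trunc n p)); apply: subset_leq_card.
  apply/fintype.subsetP => b; rewrite !inE => /andP[_ /asboolP/trunc_eqP].
  by rewrite trunc_extend => ->.
have [m mE] : exists m, n + k = m.+1 + e by exists (n + k - e).-1; lia.
rewrite addnS; move: IH; rewrite mE => IH.
rewrite card_patternsS (_ : cylinder _ _ _ =
    [set b in patterns (m.+1 + e).+1 | `[< agree n (@extend (m.+1 + e) b.1) p
      >]]%SET).
  rewrite (card_patterns_step (fun b => `[< agree n (extend b) p >])).
  by rewrite mulnAC leq_mul2r IH orbT.
apply/setP => b; rewrite !inE; congr andb.
have bb : agree n (extend b) (@extend (m.+1 + e) b.1).
  by apply: (@agree_le _ (m.+1 + e));
    [rewrite -mE leq_addr|exact: set_level_agree].
by apply/asboolP/asboolP; apply: agree_trans => //; exact: agree_sym.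
Qed.

End Counting.

(** * Compactness: cylinders of total weight below 1 do not cover *)

Section Uncovered.
Local Open Scope classical_set_scope.
Variables (R : realType) (e : nat) (P : {group {perm e.+1.-bseq bool}}).
Hypotheses (P_sub : P \subset fin_tree_aut e.+1) (P_ess : essential P).
Variables (n_ : nat -> nat) (p_ : nat -> seq bool -> bool).
Hypothesis n_gt : forall k, e < n_ k.
Hypothesis small : forall M, (\sum_(k < M) (#|patterns P (n_ k)|%:R^-1 : R) <
  1)%R.

(** If the cylinders covered all the patterns of size [N], counting would give them total weight at
    least 1. *)
Lemma finitely_uncovered M N : (forall k, k < M -> n_ k <= N) ->
  exists2 b, b \in patterns P N & forall k, k < M ->
    ~ agree (n_ k) (extend b) (p_ k).
Proof.
move=> nN; apply: contrapT => cov.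
have sub : patterns P N \subset (\bigcup_(k < M) cylinder P (n_ k) N (p_
  k))%SET.
  apply/fintype.subsetP => b bP; apply: contrapT => /negP bU; apply: cov;
    exists b => // k kM bk.
  case/negP: bU; apply/bigcupP; exists (Ordinal kM) => //.
  by rewrite inE bP; apply/asboolP.
have le : #|patterns P N| <= \sum_(k < M) #|cylinder P (n_ k) N (p_ k)|.
  apply: leq_trans (subset_leq_card sub) _.
  elim/big_rec2: _ => [|k a A _ IH]; first by rewrite cards0.
  by apply: leq_trans (leq_card_setU _ _) _; rewrite leq_add2l.
have N0 : (0 < #|patterns P N|%:R :> R)%R by rewrite ltr0n patterns_gt0.
have := small M; rewrite ltNge => /negP; apply.
rewrite -(ler_pM2l N0) mulr1 mulr_sumr.
apply: le_trans (_ : _ <= (\sum_(k < M) #|cylinder P (n_ k) N (p_ k)|)%:R)%R _.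
  by rewrite ler_nat.
rewrite natr_sum; apply: ler_sum => k _.
rewrite ler_pdivlMr ?ltr0n ?patterns_gt0 // -natrM ler_nat.
exact: card_cylinder (n_gt k) (nN _ _).
Qed.

(* The limit along an ultrafilter plays the part of compactness: every finite
   portion of the limit is a portion of some finite stage. *)
Lemma uncovered : exists p : seq bool -> bool,
  (forall n, allowed P n p) /\ (forall k, ~ agree (n_ k) p (p_ k)).
Proof.
pose N_ M := M + \sum_(k < M) n_ k.
have nN M k : k < M -> n_ k <= N_ M.
  move=> kM; rewrite /N_ (bigD1 (Ordinal kM)) //=; lia.
have {}/choice[b bP] M : exists b : seq bool -> bool, allowed P M b /\
    forall k, k < M -> ~ agree (n_ k) b (p_ k).
  have [a aP ak] := finitely_uncovered (nN M).
  exists (extend a); split=> //.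
  by apply: (@allowed_le _ _ _ (N_ M)); [exact: leq_addr|exact/patternsP].
have [U [UU sub]] := ultraFilterLemma (eventually_filter : ProperFilter
  eventually).
have meet A B : U A -> U B -> exists M, A M /\ B M.
  by move=> UA UB; apply: (@filter_ex _ U _ (A `&` B)); exact: filterI.
(* The limit of the labels at [w] along [U], which contains all the tails. *)
pose p w := `[< U [set M | b M w] >].
have pU w : U [set M | b M w = p w].
  have [Uw|Uw] := in_ultra_setVsetC [set M | b M w] UU.
    have pw : p w = true by apply/asboolP.
    by apply: filterS Uw => M /= ->; rewrite pw.
  have pw : p w = false.
    by apply/asboolPn => Uw'; have [M []] := meet _ _ Uw Uw'.
  by apply: filterS Uw => M /= /negP/negbTE ->; rewrite pw.
have pn n : U [set M | agree n p (b M)].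
  elim: n => [|n IH]; first by apply: filterS filterT => M _ w.
  have Un : U [set M | forall t : n.-tuple bool, b M t = p t].
    by apply: filter_forall => t; exact: pU.
  apply: filterS (filterI IH Un) => M [/= pM tM] w.
  rewrite ltnS leq_eqVlt => /orP[wn|]; last exact: pM.
  by rewrite -[w]/(tval (Tuple wn)) tM.
have late n : U [set M | n < M] by apply: sub; exists n.+1.
exists p; split=> [n|k pk].
  have [M [/= pM nM]] := meet _ _ (pn n) (late n).
  apply: (allowed_agree (agree_sym pM)).
  exact: allowed_le (ltnW nM) (bP M).1.
have [M [/= pM kM]] := meet _ _ (pn (n_ k)) (late k).
exact: (bP M).2 k kM (agree_trans (agree_sym pM) pk).
Qed.

End Uncovered.

(** * Distances and diameters in terms of labels *)

Section LevelDistance.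
Local Open Scope classical_set_scope.
Variable R : realType.
Implicit Types (g h : tree_aut) (U : set (tree_space R)) (n : nat).

Lemma label_agreeP n g h :
  (forall u, size u = n -> g u = h u) <-> agree n (label g) (label h).
Proof.
split=> [gh w wn|gh u un].
  have pre u : size u <= n -> g u = h u.
    (* The hypothesis speaks of words of length exactly [n]: [u] is padded to that length and the
       image is cut back. *)
    move=> uN; have := gh (u ++ nseq (n - size u) false).
    rewrite size_cat size_nseq subnKC // => /(_ erefl).
    by rewrite !ta_section => /(congr1 (take (size u)));
      rewrite !take_size_cat ?ta_size.
  have := pre (rcons w false); rewrite size_rcons => /(_ wn).
  by rewrite !ta_rcons => /rcons_inj[_].
have : size u <= n by rewrite un.
elim/last_ind: u {un} => [|u x IH]; first by rewrite !ta_nil.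
by rewrite size_rcons => uN; rewrite !ta_rcons IH ?gh // ltnW.
Qed.

(** The cosets of the level stabilizer correspond to the patterns of size [n]. *)
Lemma level_index n : grp_index (level_stab n) = 2 ^ (2 ^ n - 1).
Proof.
rewrite -card_labels_below /grp_index.
pose f (a : labels_below n) := left_coset (level_stab n) (aut_of_labels
  (extend a)).
have lab (a : labels_below n) : agree n (label (aut_of_labels (extend a)))
  (extend a).
  by move=> w _; rewrite label_aut_of_labels.
have f_inj : injective f.
  move=> a b ab; rewrite -(trunc_extend a) -(trunc_extend b); apply/trunc_eqP.
  apply: agree_trans (agree_sym (lab a)) _; apply: agree_trans (lab b).
  apply/label_agreeP => u un.
  have : f a (aut_of_labels (extend a)) by exists 1%g => //; rewrite mulg1.
  by rewrite ab => -[k kn <-]; rewrite ta_mulE kn.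
have -> : range (left_coset (level_stab n)) = [set` [fset f a | a in
  labels_below n]%fset]%classic.
  apply/seteqP; split=> [_ [g _ <-]|_ /imfsetP[a _ ->]];
    last by exists (aut_of_labels (extend a)).
  apply/imfsetP; exists (trunc n (label g)) => //.
  apply: left_coset_eq; apply/label_agreeP.
  exact: agree_trans (agree_sym (extend_trunc _)) (agree_sym (lab _)).
by rewrite set_fsetK card_imfset //= -cardE.
Qed.

Definition level_dist n : R := ((2 ^ (2 ^ n - 1))%:R^-1)%R.

Lemma level_dist_gt0 n : (0 < level_dist n)%R.
Proof. by rewrite invr_gt0 ltr0n expn_gt0. Qed.

Lemma level_dist_leP m n : (level_dist m <= level_dist n)%R -> n <= m.
Proof.
rewrite lef_pV2 ?posrE ?ltr0n ?expn_gt0 // ler_nat leq_exp2l // => nm.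
rewrite -(leq_exp2l (m := 2)) //.
by move: nm; have := expn_gt0 2 n; have := expn_gt0 2 m; lia.
Qed.

Lemma tree_dist_agree n g h : agree n (label g) (label h) ->
  (tree_dist R g h <= level_dist n)%R.
Proof.
move=> gh; rewrite /tree_dist; case: pselect => [ex|_];
  last exact/ltW/level_dist_gt0.
case: ex_minnP => m /existsP[u gu] _.
rewrite /level_dist -level_index lef_pV2 ?posrE ?ltr0n ?level_index_gt0 //
  ler_nat.
apply: level_index_le; rewrite leqNgt; apply/negP => mn.
by rewrite gh ?size_tuple // eqxx in gu.
Qed.

Lemma diameter_agree n U : (forall g h, U g -> U h ->
  agree n (label g) (label h)) ->
  (diameter U <= (level_dist n)%:E)%E.
Proof.
move=> Un; apply: ge_ereal_sup => _ [g Ug [h Uh <-]].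
by rewrite lee_fin; apply: tree_dist_agree; apply: Un.
Qed.

(** If [U] has two points, let [n] be the first level separating some pair: all of [U] lies in one
    cylinder of level [n], and that pair bounds the diameter from below. *)
Lemma diameter_cases U g : U g ->
  (forall h, U h -> h = g) \/
  exists n, (forall h, U h -> agree n (label h) (label g)) /\
            ((level_dist n)%:E <= diameter U)%E.
Proof.
move=> Ug.
have [|none] := pselect (exists n, `[< exists x y, [/\ U x, U y & differ_at x
  y n] >]).
  move=> ex; right; case: (ex_minnP ex) => n /asboolP[x [y [Ux Uy xy]]] min.
  exists n; split=> [h Uh w wn|].
    apply/eqP; apply: contraTT wn => hg; rewrite -leqNgt; apply: min;
      apply/asboolP.
    by exists h, g; split=> //; apply/existsP; exists (in_tuple w).
  apply: le_ereal_sup_tmp; exists (mdist x y)%:E; first by exists x => //;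
    exists y.
  by rewrite lee_fin /level_dist -level_index; exact: tree_dist_differ.
left=> h Uh; apply: ta_label_inj => w; apply/eqP; apply: contra_notT none => hg.
exists (size w); apply/asboolP; exists h, g; split=> //.
by apply/existsP; exists (in_tuple w).
Qed.

End LevelDistance.

(** * The Hausdorff dimension of a finitely constrained group *)

Section Dimension.
Local Open Scope classical_set_scope.
Local Open Scope ring_scope.
Variables (R : realType) (e : nat) (P : {group {perm e.+1.-bseq bool}}).
Hypotheses (P_sub : P \subset fin_tree_aut e.+1) (P_ess : essential P).
Variable r : nat.
Hypothesis card_kernel : #|top_kernel P| = (2 ^ r)%N.

Local Notation rho := (r%:R / 2 ^+ e : R).
Local Notation G_P := (fin_constrained P : set (tree_space R)).

Lemma level_dist_powR n (s : R) :
  level_dist R n `^ s = 2 `^ (- (s * (2 ^ n - 1)%:R)).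
Proof.
rewrite (_ : level_dist R n = 2 `^ (- (2 ^ n - 1)%:R)).
  by rewrite -powRrM mulNr mulrC.
by rewrite powRN powR_mulrn // -natrX.
Qed.

Lemma card_patterns_powR n : (e < n)%N ->
  #|patterns P n|%:R * (2 ^ r)%:R ^+ 2 = #|P|%:R * 2 `^ (rho * (2 ^ n)%:R) :> R.
Proof.
move=> en; have [m ->] : exists m, n = (m.+1 + e)%N by exists (n - e).-1; lia.
rewrite -natrX -natrM -[in LHS]card_kernel card_patterns // card_kernel natrM.
congr (_ * _); rewrite -expnM natrX -powR_mulrn //; congr (_ `^ _).
rewrite natrM expnD natrM (natrX _ 2 e) [X in _ = _ * X]mulrC mulrA.
by rewrite divfK // expf_neq0 // pnatr_eq0.
Qed.

(** Up to the factor |K|^2, the weight is at most 2^(- rho 2^n), while the power of the distance is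
    2^(- s (2^n - 1)) with [s <= rho]. *)
Lemma patterns_weight n (s : R) : (e < n)%N -> s <= rho ->
  #|patterns P n|%:R^-1 <= (2 ^ r)%:R ^+ 2 * level_dist R n `^ s.
Proof.
move=> en sr; have N0 : 0 < #|patterns P n|%:R :> R
  by rewrite ltr0n patterns_gt0.
rewrite -[X in X <= _]mul1r ler_pdivrMr // mulrAC [_ ^+ 2 * _]mulrC
  card_patterns_powR //.
have P1 : 1 <= #|P|%:R :> R by rewrite ler1n cardG_gt0.
apply: le_trans P1 _; rewrite -mulrA ler_peMr // level_dist_powR -powRD;
  last first.
  by rewrite pnatr_eq0 implybT.
rewrite -[X in X <= _](powRr0 2); apply: ler_powR; first by rewrite ler1n.
rewrite subr_ge0; apply: le_trans (ler_wpM2r _ sr) _ => //.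
by rewrite ler_wpM2l ?divr_ge0 ?exprn_ge0 // ler_nat leq_subr.
Qed.

Lemma patterns_weight_lt (eps : R) : (0 < r)%N -> 0 < eps ->
  exists2 n, (e < n)%N & #|patterns P n|%:R^-1 < eps.
Proof.
move=> r0 eps0.
pose C : R := (2 ^ r)%:R ^+ 2.
have C0 : 0 < C by rewrite exprn_gt0 // ltr0n expn_gt0.
have [m Cm] : exists m : nat, C / eps < m%:R.
  exists (Num.bound (C / eps)); apply: archi_boundP.
  by rewrite divr_ge0 // ltW.
exists (m.+1 + e)%N; first by rewrite addSn ltnS leq_addl.
have N0 : 0 < #|patterns P (m.+1 + e)|%:R :> R by rewrite ltr0n patterns_gt0.
rewrite -[X in X < _]mul1r ltr_pdivrMr // -(ltr_pM2r C0) mul1r -mulrA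
  -ltr_pdivrMl //.
rewrite mulrC; apply: lt_le_trans Cm _.
rewrite /C -natrX -natrM -card_kernel card_patterns // card_kernel ler_nat.
apply: leq_trans (leq_pmull _ (cardG_gt0 P)).
rewrite -expnM; apply: ltnW; apply: (@leq_trans (2 ^ m)%N);
  first exact: ltn_expl.
rewrite leq_exp2l // (leq_trans _ (leq_pmull _ r0)) // ltnW //.
by apply: ltn_trans (ltnSn m) _; exact: ltn_expl.
Qed.

Lemma diam_pow_ge0 (s : R) (U : set (tree_space R)) : (0 <= diam_pow s U)%E.
Proof. by rewrite /diam_pow; case: ifP => _ //; exact: poweR_ge0. Qed.

(** This prepares a mass distribution argument. The error [eps] takes care of sets with at most one
    point, which fit in cylinders of arbitrarily small weight. *)
Lemma cover_weight (s eps : R) (U : set (tree_space R)) :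
  (0 < r)%N -> 0 <= s <= rho -> 0 < eps ->
  (diameter U <= (level_dist R e.+1)%:E)%E ->
  exists n (p : seq bool -> bool), [/\ (e < n)%N,
    forall g : tree_aut, U g -> agree n (label g) p &
    (#|patterns P n|%:R^-1%:E <= ((2 ^ r)%:R ^+ 2)%:E * diam_pow s U +
      eps%:E)%E].
Proof.
move=> r0 /andP[s0 sr] eps0 dU.
have [n0 en0 wn0] := patterns_weight_lt r0 eps0.
have small : (#|patterns P n0|%:R^-1%:E <= ((2 ^ r)%:R ^+ 2)%:E * diam_pow s U
  + eps%:E)%E.
  apply: le_trans (_ : _ <= eps%:E)%E _; first by rewrite lee_fin ltW.
  by rewrite leeDr // mule_ge0 ?diam_pow_ge0 // lee_fin exprn_ge0.
have [->|/set0P[g Ug]] := eqVneq U set0.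
  exists n0, (fun=> false); split=> //.
  by rewrite /diam_pow; case: asboolP => // _; rewrite mule0 add0e lee_fin ltW.
have [one|[n [Un nU]]] := diameter_cases Ug.
  by exists n0, (label g); split=> // h /one ->.
(* The bound on the diameter forces the separating level to be at least [e.+1], where the counting
   formula holds. *)
have en : (e < n)%N by apply: (@level_dist_leP R);
  rewrite -lee_fin (le_trans nU).
exists n, (label g); split=> //.
rewrite -[X in (X <= _)%E]adde0; apply: leeD; last by rewrite lee_fin ltW.
apply: le_trans (_ : _ <= ((2 ^ r)%:R ^+ 2 * level_dist R n `^ s)%:E)%E _.
  by rewrite lee_fin patterns_weight.
rewrite EFinM lee_pmul2l ?lte_fin ?exprn_gt0 ?ltr0n ?expn_gt0 //.
rewrite /diam_pow; case: asboolP => [U0|_]; first by rewrite U0 in Ug.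
rewrite -poweR_EFin; apply: gt0_ler_poweR => //.
  by rewrite in_itv /= leey andbT lee_fin ltW // level_dist_gt0.
rewrite in_itv /= leey andbT; apply: le_trans nU.
by rewrite lee_fin ltW // level_dist_gt0.
Qed.

Lemma sum_half_powers M : \sum_(k < M) 2^-1 ^+ k.+2 <= 2^-1 :> R.
Proof.
suff -> : \sum_(k < M) 2^-1 ^+ k.+2 = 2^-1 - 2^-1 ^+ M.+1 :> R.
  by rewrite gerBl exprn_ge0.
elim: M => [|M IH]; first by rewrite big_ord0 expr1 subrr.
by rewrite big_ord_recr /= IH !exprS; field.
Qed.

Lemma hausdorff_measure_gt0 (s : R) : 0 <= s -> s < rho ->
  hausdorff_measure s G_P <> 0%E.
Proof.
move=> s0 sr H0.
have r0 : (0 < r)%N.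
  by rewrite lt0n; apply/eqP => r0; move: (le_lt_trans s0 sr);
    rewrite r0 mul0r ltxx.
pose C : R := (2 ^ r)%:R ^+ 2.
have C0 : 0 < C by rewrite exprn_gt0 // ltr0n expn_gt0.
(* Multiplied by [C], the cost stays below 1/2, and the errors 2^-(k+2) add at most 1/2, so the
   cylinders containing the cover have total weight below 1 and miss an element of the group. *)
have pre0 : (hausdorff_premeasure s (level_dist R e.+1) G_P < (C^-1 / 2)%:E)%E.
  apply: le_lt_trans (_ : (_ <= 0)%E) _;
    last by rewrite lte_fin divr_gt0 // invr_gt0.
  rewrite -H0; apply: ereal_sup_ubound; exists (level_dist R e.+1) => //.
  exact: level_dist_gt0.
have [_ [U [cov dU] <-] cost] := ereal_inf_lt pre0.
have s0r : 0 <= s <= rho by rewrite s0 ltW.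
have /choice[f fP] k : exists f : nat * (seq bool -> bool), [/\ (e < f.1)%N,
    forall g : tree_aut, U k g -> agree f.1 (label g) f.2 &
    (#|patterns P f.1|%:R^-1%:E <= C%:E * diam_pow s (U k) + (2^-1 ^+
      k.+2)%:E)%E].
  have [|n [p H]] := @cover_weight s (2^-1 ^+ k.+2) (U k) r0 s0r _ (dU k).
    by rewrite exprn_gt0.
  by exists (n, p).
have [||p [pP pU]] := @uncovered R e P P_sub P_ess (fun k => (f k).1) (fun k
  => (f k).2).
- by move=> k; have [] := fP k.
- move=> M; rewrite -lte_fin -sumEFin.
  apply: le_lt_trans (_ : (\sum_(k < M) (C%:E * diam_pow s (U k) + (2^-1 ^+
    k.+2)%:E) < 1)%E).
    by apply: lee_sum => k _; have [] := fP k.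
  rewrite big_split /= -ge0_sume_distrr; last by move=> k _;
    exact: diam_pow_ge0.
  rewrite sumEFin.
  have lt1 : (C%:E * (\sum_(k < M) diam_pow s (U k)) < (2^-1)%:E)%E.
    rewrite -lte_pdivlMl // -EFinM; apply: le_lt_trans cost.
    rewrite -(big_mkord xpredT (fun k => diam_pow s (U k))).
    by apply: nneseries_lim_ge => k _ _; exact: diam_pow_ge0.
  apply: lt_le_trans (lte_leD _ lt1 (_ : (_ <= (2^-1)%:E)%E)) _ => //.
    by rewrite lee_fin sum_half_powers.
  by rewrite -EFinD lee_fin; lra.
have gP : G_P (aut_of_labels p).
  apply/(fin_constrainedP P_sub) => n.
  by apply: (allowed_agree _ (pP n)) => w _; rewrite label_aut_of_labels.
have [k _ Uk] := cov _ gP.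
have [_ /(_ _ Uk) kp _] := fP k.
by apply: (pU k) => w wn; rewrite -kp // label_aut_of_labels.
Qed.

Lemma exprn_lt_eventually (x eps : R) : 0 <= x < 1 -> 0 < eps ->
  exists N, forall n, (N <= n)%N -> x ^+ n < eps.
Proof.
move=> /andP[x0 x1] eps0.
have := @cvg_expr R x; rewrite ger0_norm // => /(_ x1)/cvgrPdist_lt/(_ _
  eps0)[N _ HN].
exists N => n /HN /=; rewrite sub0r normrN ger0_norm //.
by rewrite exprn_ge0.
Qed.

(** The cylinders of level [n] cost together at most |P| 2^s x^(2^n) with x = 2^(rho - s) < 1. *)
Lemma patterns_cost (s delta eps : R) : rho < s -> 0 < delta -> 0 < eps ->
  exists2 n, level_dist R n <= delta &
    #|patterns P n|%:R * level_dist R n `^ s <= eps.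
Proof.
move=> rs delta0 eps0; pose x : R := 2 `^ (rho - s).
have x01 : 0 <= x < 1.
  rewrite powR_ge0 /= /x /powR pnatr_eq0 /= expR_lt1 pmulr_llt0 ?subr_lt0 //.
  by rewrite ln_gt0 // ltr1n.
pose C : R := #|P|%:R * 2 `^ s.
have C0 : 0 < C by rewrite mulr_gt0 ?powR_gt0 // ltr0n cardG_gt0.
have [N1 H1] := exprn_lt_eventually x01 (divr_gt0 eps0 C0).
have [|N2 H2] := @exprn_lt_eventually 2^-1 delta _ delta0; first by lra.
(* [N1] makes the cost small, [N2] the diameter, and [e.+1] gives access to the counting formula. *)
pose n := (N1 + N2 + e.+1)%N.
have en : (e < n)%N by rewrite leq_addl.
exists n.
  apply/ltW/(le_lt_trans _ (H2 n _)); last by rewrite /n; lia.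
  rewrite exprVn -natrX lef_pV2 ?posrE ?ltr0n ?expn_gt0 // ler_nat leq_exp2l //.
  by have := ltn_expl n (isT : 1 < 2)%N; lia.
apply: le_trans (_ : _ <= C * x ^+ n) _; last first.
  rewrite mulrC -ler_pdivlMr //; apply/ltW/H1; rewrite /n; lia.
apply: le_trans (_ : _ <= C * x ^+ (2 ^ n)) _; last first.
  rewrite ler_pM2l //; case/andP: x01 => x0 /ltW x1.
  by apply: ler_wiXn2l => //; apply/ltnW/ltn_expl.
have -> : C * x ^+ (2 ^ n) = #|P|%:R * 2 `^ (rho * (2 ^ n)%:R) * level_dist R
  n `^ s.
  have two0 (a b : R) : 2 `^ (a + b) = 2 `^ a * 2 `^ b.
    by rewrite powRD // pnatr_eq0 implybT.
  rewrite level_dist_powR /C -!mulrA -!two0 -powR_mulrn ?powR_ge0 // -powRrM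
    -!two0.
  congr (_ * _ `^ _); rewrite natrB ?expn_gt0 //; ring.
rewrite ler_wpM2r ?powR_ge0 // -card_patterns_powR // ler_peMr //.
by rewrite exprn_ege1 // ler1n expn_gt0.
Qed.

Lemma hausdorff_measure_eq0 (s : R) : rho < s -> hausdorff_measure s G_P = 0%E.
Proof.
move=> rs.
have pre_ge0 delta : (0 <= hausdorff_premeasure s delta G_P)%E.
  apply/ereal_infP => _ [U _ <-]; apply: nneseries_ge0 => k _ _.
  exact: diam_pow_ge0.
apply/eqP; rewrite eq_le; apply/andP; split; last first.
  apply: le_ereal_sup_tmp; exists (hausdorff_premeasure s 1 G_P) => //.
  by exists 1 => //=; exact: ltr01.
apply: ge_ereal_sup => _ [delta delta0 <-].
apply/lee_addgt0Pr => eps eps0; rewrite add0e.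
have [n n_delta cost] := patterns_cost rs delta0 eps0.
pose a0 : labels_below n := trunc n (fun=> false).
pose E := enum (patterns P n).
(* The cylinders of level [n] as a sequence, continued by empty sets, which cost nothing. *)
pose U k : set (tree_space R) :=
  [set g : tree_aut | (k < size E)%N /\ trunc n (label g) = nth a0 E k].
have dU k : (diameter (U k) <= (level_dist R n)%:E)%E.
  apply: diameter_agree => g h [_ gk] [_ hk]; apply/trunc_eqP.
  by rewrite gk hk.
apply: ge_ereal_inf; exists (\sum_(k <oo) diam_pow s (U k))%E.
  exists U => //; split=> [g /(fin_constrainedP P_sub) gP|k]; last first.
    by apply: le_trans (dU k) _; rewrite lee_fin.
  have gE : trunc n (label g) \in E by rewrite mem_enum; apply/trunc_patterns.
  exists (index (trunc n (label g)) E) => //; split; first by rewrite index_mem.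
  by rewrite nth_index.
rewrite (nneseries_split 0 (size E)); last by move=> k _; exact: diam_pow_ge0.
rewrite add0n eseries0 ?adde0; last first.
  move=> k Ek _; rewrite /diam_pow; case: asboolP => // U0.
  exfalso; apply: U0; apply/seteqP; split=> // g [kE _].
  by rewrite ltnNge Ek in kE.
have rho0 : 0 <= rho by rewrite divr_ge0 // exprn_ge0.
apply: le_trans (_ : _ <= \sum_(0 <= k < size E) (level_dist R n `^ s)%:E)%E _.
  apply: lee_sum => k _; rewrite /diam_pow; case: asboolP => [_|U0].
    by rewrite lee_fin powR_ge0.
  have [g Ug] : exists g, U k g by apply/set0P/eqP.
  have d0 : (0 <= diameter (U k))%E.
    apply: le_ereal_sup_tmp; exists (mdist (g : tree_space R) g)%:E.
      by exists g => //; exists g.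
    by rewrite lee_fin mdist_ge0.
  rewrite -poweR_EFin; apply: gt0_ler_poweR (dU k);
    first by rewrite (le_trans rho0) // ltW.
    by rewrite in_itv /= leey andbT.
  by rewrite in_itv /= leey andbT lee_fin ltW // level_dist_gt0.
rewrite sumEFin lee_fin sumr_const_nat subn0 -cardE -mulr_natl.
exact: cost.
Qed.

Lemma hausdorff_dim_fin_constrained : hausdorff_dim G_P = rho%:E.
Proof.
have rho0 : 0 <= rho by rewrite divr_ge0 // exprn_ge0.
apply/eqP; rewrite eq_le; apply/andP; split.
  apply/lee_addgt0Pr => eps eps0; apply: ge_ereal_inf.
  exists (rho + eps)%:E; last by rewrite EFinD.
  exists (rho + eps) => //; split; first by rewrite addr_ge0 // ltW.
  by apply: hausdorff_measure_eq0; rewrite ltrDl.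
apply/ereal_infP => _ [s [s0 sH] <-]; rewrite lee_fin leNgt; apply/negP => sr.
exact: hausdorff_measure_gt0 s0 sr sH.
Qed.

End Dimension.

(** * The equivalence of the three conditions *)

Theorem theorem1 (R : realType) (d : nat) (P : {group {perm d.-bseq bool}})
    (d_ge2 : (2 <= d)%N)
    (P_sub : P \subset fin_tree_aut d)
    (P_ess : essential P) :
  (hausdorff_dim (fin_constrained P : set (tree_space R)) =
     (1 - (2 ^+ d.-1)^-1 : R)%R%:E
   <->
   P \proper fin_tree_aut d /\
     [~: fin_tree_aut d, fin_tree_aut d]%g \subset P)
  /\
  (P \proper fin_tree_aut d /\
     [~: fin_tree_aut d, fin_tree_aut d]%g \subset P
   <->
   maximal P (fin_tree_aut d) /\ agen d d.-1 \notin P).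
Proof.
case: d P d_ge2 P_sub P_ess => [//|e] P _ P_sub P_ess.
have [r rE] := card_top_kernel P.
(* r / 2^e = 1 - 1 / 2^e means r + 1 = 2^e, that is, K is a hyperplane; all three conditions are
   compared with this one. *)
have dim_half : hausdorff_dim (fin_constrained P : set (tree_space R)) =
    (1 - (2 ^+ e)^-1 : R)%R%:E <-> #|top_kernel P|.*2 = 2 ^ 2 ^ e.
  have two_neq0 : (2 ^+ e != 0 :> R)%R by rewrite expf_neq0 // pnatr_eq0.
  rewrite (hausdorff_dim_fin_constrained R P_sub P_ess rE) rE -mul2n -expnS.
  split=> [[/(canRL (divfK two_neq0))]|/eqP].
    rewrite mulrBl mul1r mulVf // => /(canLR (subrK _)).
    by rewrite natr1 -natrX => /eqP; rewrite eqr_nat => /eqP ->.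
  rewrite eqn_exp2l // => /eqP re; congr EFin.
  apply: (canLR (mulfK two_neq0)).
  by rewrite mulrBl mul1r mulVf // -natrX -re -natr1 addrK.
have der_iff : P \proper fin_tree_aut e.+1 /\
    [~: fin_tree_aut e.+1, fin_tree_aut e.+1]%g \subset P <->
    #|top_kernel P|.*2 = 2 ^ 2 ^ e.
  split=> [[pP dP]|half]; first exact: der_half.
  exact/maximal_der/half_maximal.
split; first by rewrite der_iff.
rewrite der_iff; split=> [half|[maxP _]].
  by split; [exact: half_maximal|exact: half_agen].
by have [pP dP] := maximal_der maxP; exact: der_half.
Qed.
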